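(* Let $C_1$ and $C_2$ be two nonempty, closed and convex subsets of a real Hilbert space $(H, \langle \cdot, \cdot \rangle)$ with induced norm $| \cdot |$, and let $P_1 : H \to C_1$ and $P_2 : H \to C_2$ be the corresponding nearest point projections of $H$ onto $C_1$ and $C_2$, respectively. Let $x_0 \in H$ be arbitrary and let the sequence $\{x_n : n \in \mathbb{N}\}$ be defined by $x_{2n+1} = P_1 x_{2n}$ and $x_{2n+2} = P_2 x_{2n+1}$ for all $n \in \mathbb{N}$. Then $$\lim_{n \rightarrow \infty}|x_{2n+2} - x_{2n+1}| = \lim_{n \rightarrow \infty}|x_{2n+1} - x_{2n}| = \mathrm{d}(C_1, C_2).$$
   Context: $\mathbb{N} = \{0, 1, 2, \dots\}$ denotes the set of nonnegative integers. For a nonempty, closed and convex subset $C$ of $H$, the nearest point projection of $H$ onto $C$ maps each $x \in H$ to the unique point of $C$ closest to $x$ in the norm $|\cdot|$. The distance between $C_1$ and $C_2$ is $\mathrm{d}(C_1, C_2) := \inf\{|x - y| : x \in C_1,\ y \in C_2\}$; it is not assumed to be attained, and $C_1$ and $C_2$ are allowed to be disjoint. *)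

(* Defs.v *)
From HB Require Import structures.
From mathcomp Require Import all_boot all_order all_algebra.
From mathcomp Require Import all_classical all_reals all_analysis.

Set Implicit Arguments.
Unset Strict Implicit.
Unset Printing Implicit Defensive.

Import Order.TTheory GRing.Theory Num.Theory.
Import numFieldNormedType.Exports.

Local Open Scope classical_set_scope.
Local Open Scope ring_scope.

(* A real Hilbert space is a complete normed module [H] together with a real
   inner product, i.e. a symmetric ([idfun] is the conjugation of the reals)
   positive definite bilinear form, such that the norm of [H], hence also its
   topology, is the one induced by the inner product. *)
Definition induces_norm (R : realType) (H : completeNormedModType R)
    (ip : {dot H for @idfun R}) : Prop :=
  forall x : H, `|x| = Num.sqrt (ip x x).

Section ConvexSets.
Context {R : realType} {H : completeNormedModType R}.
Implicit Types (C : set H) (x : H).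

Definition nearest_points C x : set H :=
  [set p | C p /\ forall y, C y -> `|x - p| <= `|x - y|].

(* In a Hilbert space [nearest_points C x] is a singleton when [C] is nonempty,
   closed and convex, so that [get] returns its unique element. *)
Definition nearest_point_proj C x : H := get (nearest_points C x).

Definition set_dist C1 C2 : R := inf [set `|x - y| | x in C1 & y in C2].

End ConvexSets.

(* Main.v *)
Require Import Defs.
From HB Require Import structures.
From mathcomp Require Import all_boot all_order all_algebra.
From mathcomp Require Import all_classical all_reals all_analysis.
From mathcomp Require Import lra.

Import Order.TTheory GRing.Theory Num.Theory.
Import numFieldNormedType.Exports.

(** Write $u_k = x_{2k}$, $p_k = x_{2k+1} = P_1 u_k$ and
    $u_{k+1} = x_{2k+2} = P_2 p_k$.  At the nearest point of a convex set,
    the directions towards the projected point and towards any point of the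
    set form an angle that is not acute ([nearest_points_obtuse]), and this
    yields two inequalities between
    squared distances, valid for all $y \in C_1$ and $z \in C_2$:
      $|p_k - u_{k+1}|^2 + |u_{k+1} - z|^2 \le |p_k - z|^2$ ([three_point]),
      $|p_k - z|^2 \le |y - z|^2 + |u_k - z|^2$ ([four_point]).
    Together they say that one turn of the iteration lowers the energy
    $|u_k - z|^2$ by at least $|p_k - u_{k+1}|^2 - |y - z|^2$.  The gaps
    $|p_k - u_{k+1}|$ are nonincreasing, because each projection competes with
    the previous iterate in the same set.  If they all stayed above
    $d(C_1, C_2) + \varepsilon$, then, for a pair $(y, z)$ that is closer than
    $d(C_1, C_2) + \varepsilon$, each turn would consume at least a fixed
    positive amount of an energy that is nonnegative and finite at the start.
    So the gaps tend to $d(C_1, C_2)$, and the other gaps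
    $|u_{k+1} - p_{k+1}|$ are squeezed between $d(C_1, C_2)$ and them.

    The projection is a point chosen among the minimizers of the distance, so
    all this rests on the existence of a minimizer ([nearest_points_neq0]):
    by the parallelogram law minimizing sequences are Cauchy, and the space
    is complete. *)

Local Open Scope classical_set_scope.
Local Open Scope ring_scope.

Section InnerProduct.
Set Implicit Arguments.
Unset Strict Implicit.
Context (R : realType) (H : completeNormedModType R) (ip : {dot H for @idfun R}).
Context (ip_norm : induces_norm ip).
Implicit Types (C : set H) (a b p u x y z : H).

Lemma ip_ge0 a : 0 <= ip a a.
Proof.
have [->|a0] := eqVneq a 0; first by rewrite linear0l.
exact/ltW/neq0_dnorm_gt0.
Qed.

Lemma sqr_norm a : `|a| ^+ 2 = ip a a.
Proof. by rewrite ip_norm sqr_sqrtr// ip_ge0. Qed.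

Lemma ip_sym a b : ip a b = ip b a.
Proof. by rewrite hermC expr0 mul1r. Qed.

Lemma sqr_normD a b : `|a + b| ^+ 2 = `|a| ^+ 2 + 2 * ip a b + `|b| ^+ 2.
Proof.
by rewrite !sqr_norm linearDl !linearDr /= (ip_sym b a); lra.
Qed.

Lemma convex_set_comb C (t : R) a b : @convex_set R H C -> 0 <= t <= 1 ->
  C a -> C b -> C (t *: a + (1 - t) *: b).
Proof.
move=> cC /andP[t0 t1] Ca Cb.
have t01 : Itv.spec (@Itv.num_sem R) (Itv.Real `[0%Z, 1%Z]) t.
  rewrite /= /Itv.num_sem /= in_itv /= t0 t1 !andbT; exact: num_real.
have := cC a b (Itv.mk t01); rewrite !inE; exact.
Qed.

Lemma ipZl (t : R) a b : ip (t *: a) b = t * ip a b.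
Proof. exact: linearZl_LR. Qed.

Lemma ipZr (t : R) a b : ip a (t *: b) = t * ip a b.
Proof. exact: linearZr_LR. Qed.

(** The parallelogram law for $x - a$ and $x - b$.  The midpoint is spelled as
    the convex combination that convexity provides, so that the right-hand
    side bounds the spread of two almost nearest points. *)
Lemma parallelogram_mid x a b :
  `|a - b| ^+ 2 = 2 * `|x - a| ^+ 2 + 2 * `|x - b| ^+ 2
    - 4 * `|x - (2^-1 *: a + (1 - 2^-1) *: b)| ^+ 2.
Proof.
rewrite !sqr_norm !(linearBl, linearBr, linearDl, linearDr) /= !(ipZl, ipZr).
by rewrite (ip_sym b a) (ip_sym a x) (ip_sym b x); lra.
Qed.

(** Hilbert's projection theorem: two points of [C] whose squared distances to
    [x] exceed the infimum by little have a midpoint in [C], whose squared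
    distance is at least the infimum; the parallelogram law then forces the
    two points to be close to each other. *)
Lemma nearest_points_neq0 C x : C !=set0 -> closed C -> @convex_set R H C ->
  nearest_points C x !=set0.
Proof.
move=> [c0 Cc0] Ccl Ccv.
pose E : set R := [set `|x - y| ^+ 2 | y in C].
have Einf : has_inf E.
  by split; [exists (`|x - c0| ^+ 2), c0 | exists 0 => _ [y _ <-]].
have leE y : C y -> inf E <= `|x - y| ^+ 2.
  by move=> Cy; apply: ge_inf; [exact: Einf.2 | exists y].
have /choice[y ys] (n : nat) :
    exists y, C y /\ `|x - y| ^+ 2 < inf E + (n.+1%:R)^-1.
  have [|_ [y Cy <-] yn] := @inf_adherent _ E (n.+1%:R^-1) _ Einf.
    by rewrite invr_gt0.
  by exists y.
have ycauchy m n : (m <= n)%N -> `|y m - y n| ^+ 2 <= 4 * m.+1%:R^-1.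
  move=> mn.
  have [Cm ym] := ys m; have [Cn yn] := ys n.
  have half01 : 0 <= (2^-1 : R) <= 1 by apply/andP; split; lra.
  have /leE := convex_set_comb Ccv half01 Cm Cn.
  have nm : n.+1%:R^-1 <= m.+1%:R^-1 :> R.
    by rewrite lef_pV2 ?posrE ?ltr0n// ler_nat.
  rewrite (parallelogram_mid x (y m)); move: ym yn nm.
  by set A := _%:R^-1; set B := _%:R^-1; lra.
have ycvg : cvg (y @ \oo).
  apply: cauchy_cvg; apply: cauchy_exP => e e0.
  have e4 : 0 < e ^+ 2 / 4 by rewrite divr_gt0// exprn_gt0.
  have /cvgrPdist_lt/(_ _ e4)[N _ Ne] := @cvg_harmonic R.
  exists (y N); exists N => // n /= Nn; rewrite -ball_normE /=.
  rewrite -(@ltr_pXn2r _ 2)// ?nnegrE ?(ltW e0)//.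
  have := Ne _ (leqnn N); rewrite /= sub0r normrN ger0_norm ?invr_ge0// => hN.
  apply: le_lt_trans (ycauchy _ _ Nn) _.
  by rewrite -ltr_pdivlMl// mulrC.
exists (lim (y @ \oo)); split.
  apply: (@closed_cvg _ H _ _ y C Ccl _ _ ycvg).
  by apply: nearW => n; have [] := ys n.
move=> z Cz; rewrite -(@ler_pXn2r _ 2)// ?nnegrE//.
apply: le_trans (leE _ Cz).
have dcvg : `|x - y n| ^+ 2 - n.+1%:R^-1 @[n --> \oo] -->
    `|x - lim (y @ \oo)| ^+ 2 - 0.
  apply: cvgB; last exact: cvg_harmonic.
  under eq_fun do rewrite expr2.
  by rewrite expr2; apply: cvgM; apply: cvg_norm; apply: cvgB => //;
     exact: cvg_cst.
rewrite -[leLHS]subr0; apply: (cvgr_to_le dcvg).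
by apply: nearW => n; have [_] := ys n; rewrite lerBlDr => /ltW.
Qed.

Lemma nearest_point_projP C x : C !=set0 -> closed C -> @convex_set R H C ->
  nearest_points C x (nearest_point_proj C x).
Proof.
by move=> C0 Ccl Ccv; have [p] := nearest_points_neq0 x C0 Ccl Ccv; exact: getI.
Qed.

(** Moving from [p] towards [y] stays in [C], so it cannot decrease the distance
    to [x]: the derivative of the squared distance at [p] is nonnegative. *)
Lemma nearest_points_obtuse C x p y : @convex_set R H C ->
  nearest_points C x p -> C y -> ip (x - p) (y - p) <= 0.
Proof.
move=> Ccv [Cp minp] Cy; rewrite leNgt; apply/negP => s0.
set s := ip _ _ in s0; set N := ip (y - p) (y - p).
have N0 : 0 <= N := ip_ge0 _.
(* The step t changes the squared distance by t * (t * N - 2 * s), so any t in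
   ]0, 1] such that t * N < 2 * s gets nearer to x. *)
pose t := s / (s + N).
have den0 : 0 < s + N by lra.
have t0 : 0 < t by rewrite divr_gt0.
have t1 : t <= 1 by rewrite ler_pdivrMr// mul1r; lra.
have tN : t * N <= s.
  by rewrite mulrAC ler_pdivrMr// ler_pM2l//; lra.
have t01 : 0 <= t <= 1 by rewrite t1 ltW.
have := minp _ (convex_set_comb Ccv t01 Cy Cp).
rewrite -(@ler_pXn2r _ 2)// ?nnegrE//.
have -> : x - (t *: y + (1 - t) *: p) = (x - p) + (- t) *: (y - p).
  rewrite scaleNr scalerBr scalerBl scale1r !opprD !opprK !addrA.
  by rewrite [x - p - _]addrAC.
by rewrite (sqr_normD (x - p)) ipZr !sqr_norm ipZl ipZr -/s -/N; nra.
Qed.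

(** Pythagoras as an inequality: the angle at the nearest point is at least
    right. *)
Lemma three_point C x p z : @convex_set R H C -> nearest_points C x p -> C z ->
  `|x - p| ^+ 2 + `|p - z| ^+ 2 <= `|x - z| ^+ 2.
Proof.
move=> Ccv xp Cz; have := nearest_points_obtuse Ccv xp Cz.
rewrite !sqr_norm !(linearBl, linearBr) /=.
by rewrite (ip_sym p x) (ip_sym z x) (ip_sym z p); lra.
Qed.

(** The right-hand side minus the left-hand side equals
    $|(y - p) + (u - p) - (z - p)|^2 - 2 \langle u - p, y - p \rangle$. *)
Lemma four_point C u p y z : @convex_set R H C -> nearest_points C u p -> C y ->
  `|p - z| ^+ 2 <= `|y - z| ^+ 2 + `|u - z| ^+ 2.
Proof.
move=> Ccv up Cy; have := nearest_points_obtuse Ccv up Cy.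
have := ip_ge0 (y + u - p - z).
rewrite !sqr_norm !(linearBl, linearBr, linearDl, linearDr) /=.
by rewrite (ip_sym p y) (ip_sym z y) (ip_sym z p) (ip_sym u y) (ip_sym p u) (ip_sym z u); lra.
Qed.

End InnerProduct.

Theorem theorem1p4 (R : realType) (H : completeNormedModType R)
    (ip : {dot H for @idfun R}) (ip_norm : induces_norm ip)
    (C1 C2 : set H)
    (C1_neq0 : C1 !=set0) (C1_closed : closed C1) (C1_convex : @convex_set R H C1)
    (C2_neq0 : C2 !=set0) (C2_closed : closed C2) (C2_convex : @convex_set R H C2)
    (x0 : H) (x : nat -> H)
    (x_0 : x 0%N = x0)
    (x_odd : forall n, x (2 * n + 1)%N = nearest_point_proj C1 (x (2 * n)%N))
    (x_even : forall n, x (2 * n + 2)%N = nearest_point_proj C2 (x (2 * n + 1)%N)) :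
  (`|x (2 * n + 2)%N - x (2 * n + 1)%N| @[n --> \oo] --> set_dist C1 C2) /\
  (`|x (2 * n + 1)%N - x (2 * n)%N| @[n --> \oo] --> set_dist C1 C2).
Proof.
pose p k := x (2 * k + 1)%N; pose u k := x (2 * k)%N.
have uS k : u k.+1 = x (2 * k + 2)%N by rewrite /u mulnS addnC.
have pP k : nearest_points C1 (u k) (p k).
  by rewrite /p x_odd; exact: (nearest_point_projP ip_norm).
have uP k : nearest_points C2 (p k) (u k.+1).
  by rewrite uS x_even; exact: (nearest_point_projP ip_norm).
pose b k := `|p k - u k.+1|; pose c k := `|u k - p k|.
set d := set_dist C1 C2.
have dist_inf : has_inf [set `|y - z| | y in C1 & z in C2].
  split; last by exists 0 => _ [y _ [z _ <-]].
  by case: C1_neq0 C2_neq0 => [y C1y] [z C2z]; exists `|y - z|, y => //; exists z.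
have dle y z : C1 y -> C2 z -> d <= `|y - z|.
  by move=> C1y C2z; apply: (ge_inf dist_inf.2); exists y => //; exists z.
have db k : d <= b k by apply: dle; [exact: (pP k).1 | exact: (uP k).1].
have dc k : d <= c k.+1.
  by rewrite /c distrC; apply: dle; [exact: (pP _).1 | exact: (uP k).1].
have cb k : c k.+1 <= b k.
  by rewrite /b distrC; apply: (pP k.+1).2; exact: (pP k).1.
have bc k : b k.+1 <= c k.+1.
  by rewrite /c distrC; apply: (uP k.+1).2; exact: (uP k).1.
have b_anti : nonincreasing_seq b.
  by apply/nonincreasing_seqP => k; exact: le_trans (bc k) (cb k).
(* As b is nonincreasing, b N bounds each of the first N gaps from below. *)
have energy y z N : C1 y -> C2 z ->
    N%:R * (b N ^+ 2 - `|y - z| ^+ 2) + `|u N - z| ^+ 2 <= `|u 0%N - z| ^+ 2.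
  move=> C1y C2z; elim: N => [|N IH]; first by rewrite mul0r add0r.
  apply: le_trans IH.
  have := three_point ip_norm C2_convex (uP N) C2z.
  have := four_point ip_norm z C1_convex (pP N) C1y.
  rewrite -/(b N).
  have : b N.+1 ^+ 2 <= b N ^+ 2.
    by rewrite ler_pXn2r ?nnegrE ?normr_ge0//; exact: b_anti (leqnSn N).
  have : 0 <= N%:R :> R by [].
  by rewrite -natr1; nra.
have d0 : 0 <= d by apply: lb_le_inf; [exact: dist_inf.1 | move=> _ [y _ [z _ <-]]].
have b_cvg : b @ \oo --> d.
  apply/cvgrPdist_le => e e0.
  suff [N bN] : exists N, b N <= d + e.
    exists N => // n /= Nn; rewrite distrC ger0_norm ?subr_ge0// lerBlDl.
    exact: le_trans (b_anti _ _ Nn) bN.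
  have [_ [y C1y [z C2z <-]] yz] := inf_adherent e0 dist_inf.
  apply: contrapT => /forallNP bN.
  have gap0 : 0 < (d + e) ^+ 2 - `|y - z| ^+ 2.
    by rewrite subr_gt0 ltr_pXn2r ?nnegrE ?addr_ge0 ?(ltW e0)//.
  (* If b stays above d + e, then N * ((d + e)^2 - |y - z|^2) is bounded by
     the initial energy for every N, against the archimedean property. *)
  have := archi_boundP (divr_ge0 (sqr_ge0 `|u 0%N - z|) (ltW gap0)).
  set N := Num.bound _; rewrite ltr_pdivrMr// ltNge => /negP; apply.
  apply: le_trans (energy y z N C1y C2z).
  rewrite -[leLHS]addr0 lerD ?sqr_ge0// ler_wpM2l// lerD2r.
  rewrite ler_pXn2r ?nnegrE ?addr_ge0 ?(ltW e0) ?(le_trans d0 (db _))//.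
  by move/negP: (bN N); rewrite -ltNge => /ltW.
have c_cvg : c @ \oo --> d.
  rewrite -cvg_shiftS; apply: squeeze_cvgr (@cvg_cst _ _ _ _ _) b_cvg.
  by apply: nearW => k; rewrite dc cb.
split.
  by under eq_fun do rewrite -uS distrC.
by under eq_fun do rewrite distrC.
Qed.
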